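(* Let $a \in \mathbb{Z}^n$ be non-zero, $b\in\mathbb{Z}$, $\Delta=\lVert a\rVert_\infty$, and let $\mathcal{P}_I = \operatorname{Conv}(\{x\in\mathbb{R}^n : a^\top x = b,\ x\ge 0\}\cap\mathbb{Z}^n)$ be the integer hull of the knapsack polytope. The number of vertices of $\mathcal{P}_I$ is at most $(n\cdot\log(\Delta))^{O(\log(\Delta))}$.
   Context: All logarithms are base 2; the $O(\cdot)$ hides an absolute constant. A vertex of $\mathcal{P}_I$ is a point $v\in\mathcal{P}_I$ with $v\notin\operatorname{Conv}(\mathcal{P}_I\setminus\{v\})$.
   Formalization: The formal statement assumes Δ ≥ 2; for Δ = 1 one has log Δ = 0, so the bound reads 0^0, and it fails e.g. for a = (1,1), b = 1, where the integer hull has two vertices. *)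

(* Defs.v *)
From HB Require Import structures.
From mathcomp Require Import all_boot all_order all_algebra finmap.
From mathcomp Require Import all_classical all_reals all_analysis.

Set Implicit Arguments.
Unset Strict Implicit.
Unset Printing Implicit Defensive.

Import Order.TTheory GRing.Theory Num.Theory.

Local Open Scope classical_set_scope.
Local Open Scope ring_scope.

Definition conv_hull (R : realType) (n : nat) (A : set 'cV[R]_n) :
    set 'cV[R]_n :=
  [set x | exists (k : nat) (w : 'I_k -> R) (p : 'I_k -> 'cV[R]_n),
    [/\ forall i, 0 <= w i, \sum_(i < k) w i = 1, forall i, A (p i) &
        x = \sum_(i < k) w i *: p i]].

Definition knapsack (R : realType) (n : nat) (a : 'cV[int]_n) (b : int) :
    set 'cV[R]_n :=
  [set x | (map_mx intr a)^T *m x = (b%:~R)%:M /\ forall i, 0 <= x i 0].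
Arguments knapsack R {n} a b _.

Definition int_points (R : realType) (n : nat) : set 'cV[R]_n :=
  [set x | forall i, x i 0 \is a Num.int].
Arguments int_points : clear implicits.

Definition integer_hull (R : realType) (n : nat) (a : 'cV[int]_n) (b : int) :
    set 'cV[R]_n :=
  conv_hull (knapsack R a b `&` int_points R n).
Arguments integer_hull R {n} a b _.

Definition vertices (R : realType) (n : nat) (P : set 'cV[R]_n) :
    set 'cV[R]_n :=
  [set v | P v /\ ~ conv_hull (P `\ v) v].

Definition log2 (R : realType) (x : R) : R := ln x / ln 2.

(* Main.v *)
(** A vertex [v] of the integer hull is a nonnegative integer point that admits
    no nonzero integer [z] in the kernel of [a] with [|z| <= v] entrywise, since
    otherwise [v] is the midpoint of [v - z] and [v + z].  Three choices of [z]
    give the bound.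
    - Differences of indicator vectors: all subset sums of [a] over the support
      of [v] are distinct, so the support has size [O(log Delta)].
    - [z = a_j e_i - a_i e_j]: at most one entry of [v] is at least [Delta].
    - [z = w - v] for another vertex [w]: if [v] and [w] have the same support
      and, for every entry below [Delta], the same integer part of its binary
      logarithm, then [w <= 2 v] or [v <= 2 w], hence [v = w].
    So a vertex is determined by [O(log Delta)] pairs of an index and one of
    [O(log Delta)] classes. *)
Require Import Defs.
From HB Require Import structures.
From mathcomp Require Import all_boot all_order all_algebra finmap.
From mathcomp Require Import all_classical all_reals all_analysis.
From mathcomp Require Import zify lra.

Import Order.TTheory GRing.Theory Num.Theory.

Local Open Scope classical_set_scope.
Local Open Scope ring_scope.

(** * Support and large entries of rigid vectors *)

Definition rigid {n : nat} (a : 'I_n -> int) (x : 'I_n -> nat) : Prop :=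
  forall z : 'I_n -> int, \sum_i a i * z i = 0 ->
    (forall i, (`|z i| <= x i)%N) -> forall i, z i = 0.

Definition supp {n : nat} (x : 'I_n -> nat) : {set 'I_n} :=
  [set i | (0 < x i)%N]%SET.

(** If [a i] vanished, the unit vector at [i] would be a forbidden kernel vector. *)
Lemma rigid_coef_neq0 {n : nat} {a : 'I_n -> int} {x : 'I_n -> nat} {i : 'I_n} :
  rigid a x -> (0 < x i)%N -> a i != 0.
Proof.
move=> rx xi; apply/eqP => ai0.
have /(_ i) : forall k, (k == i)%:Z = 0.
  apply: rx => [|k]; last by case: eqP => [->|].
  rewrite big1 // => k _; case: eqP => [->|_]; last by rewrite mulr0.
  by rewrite ai0 mul0r.
by rewrite eqxx.
Qed.

Lemma rigid_large_unique {n : nat} {a : 'I_n -> int} {x : 'I_n -> nat}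
    {D : nat} {i j : 'I_n} :
  rigid a x -> (0 < D)%N -> (forall k, (`|a k| <= D)%N) ->
  (D <= x i)%N -> (D <= x j)%N -> i = j.
Proof.
move=> rx D0 aD xi xj; apply/eqP/negPn/negP => ij.
have ji : j != i by rewrite eq_sym.
pose z k : int := a j *+ (k == i) - a i *+ (k == j).
have /(_ i) : forall k, z k = 0.
  apply: rx => [|k]; rewrite /z.
    rewrite (bigD1 i) //= (bigD1 j) //= big1 => [|k /andP[ki kj]].
      by rewrite !eqxx (negPf ij) (negPf ji) !mulr1n !mulr0n; lia.
    by rewrite (negPf ki) (negPf kj) !mulr0n subr0 mulr0.
  have := aD i; have := aD j.
  case: (eqVneq k i) => [->|_]; first by rewrite (negPf ij); lia.
  by case: (eqVneq k j) => [->|_]; lia.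
rewrite /z eqxx (negPf ij) mulr1n mulr0n subr0 => /eqP.
by apply/negP/(rigid_coef_neq0 rx); lia.
Qed.

(* Pigeonhole on the [2 ^ #|supp x|] subset sums of [a]: two equal ones differ
   by a kernel vector with entries in [-1, 0, 1] supported in [supp x]. *)
Lemma rigid_subset_sums {n : nat} {a : 'I_n -> int} {x : 'I_n -> nat}
    {D : nat} :
  rigid a x -> (forall k, (`|a k| <= D)%N) ->
  (2 ^ #|supp x| <= (2 * (#|supp x| * D)).+1)%N.
Proof.
move=> rx aD; set t := #|supp x|.
pose s (A : {set 'I_n}) : int := \sum_(i in A) a i.
have sle (A : {set 'I_n}) : A \subset supp x -> `|s A| <= (t * D)%:Z.
  move=> Ax; apply: (le_trans (ler_norm_sum _ _ _)).
  apply: (@le_trans _ _ (\sum_(i in A) D%:Z)).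
    by apply: ler_sum => i _; have := aD i; lia.
  rewrite sumr_const -mulr_natr natz.
  by have := subset_leq_card Ax; rewrite -/t; nia.
(* Shifting by [t * D] puts every sum in the range from 0 to [2 * (t * D)], so [inord] never takes
   its default value. *)
pose f A : 'I_(2 * (t * D)).+1 := inord `|(s A + (t * D)%:Z)%R|%N.
rewrite -(card_powerset (supp x)) -[leqRHS]card_ord.
have <- : #|f @: powerset (supp x)| = #|powerset (supp x)|.
  apply: card_in_imset => A B; rewrite !inE => Ax Bx /(congr1 val).
  have := sle _ Ax; have := sle _ Bx; move=> sB sA.
  rewrite /= !inordK; [move=> sAB | lia | lia].
  have eAB : s A = s B by lia.
  have z0 : forall k, (k \in A)%:Z - (k \in B)%:Z = 0.
    apply: rx => [|k].
      under eq_bigr do rewrite mulrBr -!natz !mulr_natr !mulrb.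
      by rewrite sumrB -!big_mkcond /= -/(s A) -/(s B) eAB subrr.
    have := fintype.subsetP Ax k; have := fintype.subsetP Bx k; rewrite inE.
    move=> hB hA; case: (k \in A) hA => [/(_ isT)|_];
      by case: (k \in B) hB => [/(_ isT)|_]; lia.
  apply/setP => k; have := z0 k.
  by case: (k \in A); case: (k \in B).
exact: max_card.
Qed.

Lemma rigid_support {n : nat} {a : 'I_n -> int} {x : 'I_n -> nat} {D : nat} :
  rigid a x -> (1 < D)%N -> (forall k, (`|a k| <= D)%N) ->
  (#|supp x| <= 2 * trunc_log 2 D + 4)%N.
Proof.
move=> rx D1 aD; have := rigid_subset_sums rx aD.
set t := #|supp x|; set L := trunc_log 2 D => le2t.
rewrite leqNgt; apply/negP => ltt.
have DL : (D < 2 ^ L.+1)%N by exact: trunc_log_ltn.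
have L1 : (0 < L)%N by rewrite trunc_log_gt0.
have lin u : (2 < u)%N -> (2 * u < 2 ^ u)%N.
  elim: u => // u IH; rewrite ltnS leq_eqVlt => /orP[/eqP <- //|u2].
  by have := IH u2; rewrite expnS; lia.
(* As [t > 2 * L + 4], we get [t <= 2 * u < 2 ^ u]; with [D < 2 ^ L.+1] this makes [2 ^ t] exceed
   [2 * t * D + 1]. *)
pose u := (t - L.+2)%N.
have tE : t = (L.+2 + u)%N by rewrite /u; lia.
have := lin u ltac:(rewrite /u; lia).
have : (t <= 2 * u)%N by rewrite /u; lia.
move: le2t; rewrite [in (2 ^ _)%N]tE expnD [(2 ^ L.+2)%N]expnS.
move: (2 ^ L.+1)%N (2 ^ u)%N DL => P Q DP; nia.
Qed.

(** * Comparing rigid vectors by dyadic classes *)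

(** All values from [D] on share one extra class, which keeps the number of classes logarithmic in
    [D]. For [D > 1] the values 0 and 1 share a class, so classes are compared on supports only. *)
Definition dyadic_class (D m : nat) : nat :=
  if (m < D)%N then trunc_log 2 m else (trunc_log 2 D).+1.

Lemma dyadic_class_ltn (D m : nat) :
  (dyadic_class D m < (trunc_log 2 D).+2)%N.
Proof.
rewrite /dyadic_class; case: ifP => // /ltnW mD.
by rewrite !ltnS leqW // leq_trunc_log.
Qed.

Lemma eq_dyadic_class_small (D m k : nat) :
  dyadic_class D m = dyadic_class D k -> (m < D)%N -> (0 < m)%N ->
  (0 < k)%N -> (m <= 2 * k)%N.
Proof.
rewrite /dyadic_class => + mD m0 k0; rewrite mD; case: ifP => kD mk.
  have := @trunc_log_ltn 2 m isT; have := @trunc_logP 2 k isT k0.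
  by rewrite mk expnS; lia.
by have := leq_trunc_log 2 (ltnW mD); lia.
Qed.

(** For natural numbers, [y i <= 2 * x i] says that [x i - y i] is at most [x i] in absolute value,
    so [x - y] is an admissible kernel vector. *)
Lemma rigid_dominated {n : nat} {a : 'I_n -> int} {x y : 'I_n -> nat} :
  rigid a x -> \sum_i a i * (x i)%:Z = \sum_i a i * (y i)%:Z ->
  (forall i, (y i <= 2 * x i)%N) -> x =1 y.
Proof.
move=> rx exy yx i.
have /(_ i) : forall k, (x k)%:Z - (y k)%:Z = 0; last by lia.
apply: rx => [|k]; last by have := yx k; lia.
by under eq_bigr do rewrite mulrBr; rewrite sumrB exy subrr.
Qed.

(* Equal classes give [x i <= 2 * y i] and [y i <= 2 * x i] except at the single
   index with a large entry; there, comparing [x] and [y] chooses which of the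
   two vectors is not rigid unless they agree. *)
Lemma rigid_eq {n : nat} {a : 'I_n -> int} {x y : 'I_n -> nat} {D : nat} :
  rigid a x -> rigid a y -> (0 < D)%N -> (forall k, (`|a k| <= D)%N) ->
  \sum_i a i * (x i)%:Z = \sum_i a i * (y i)%:Z ->
  supp x = supp y ->
  {in supp x, forall i, dyadic_class D (x i) = dyadic_class D (y i)} ->
  x =1 y.
Proof.
move=> rx ry D0 aD exy sxy cxy.
have posE i : (0 < x i)%N = (0 < y i)%N.
  by move/setP: sxy => /(_ i); rewrite !inE.
have small i : (x i < D)%N \/ (y i < D)%N ->
    (x i <= 2 * y i)%N /\ (y i <= 2 * x i)%N.
  have [x0|x0] := posnP (x i); first by have := posE i; rewrite x0; lia.
  have y0 : (0 < y i)%N by rewrite -posE.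
  have cE : dyadic_class D (x i) = dyadic_class D (y i).
    by apply: cxy; rewrite inE.
  have large m k : (m < D)%N -> (D <= k)%N ->
      dyadic_class D m != dyadic_class D k.
    move=> mD kD; rewrite /dyadic_class mD ltnNge kD /=.
    by have := leq_trunc_log 2 (ltnW mD); lia.
  move=> xyD; have [xD yD] : (x i < D)%N /\ (y i < D)%N.
    case: (ltnP (x i) D) (ltnP (y i) D) => xD [] yD //; last by lia.
      by have := large _ _ xD yD; rewrite cE eqxx.
    by have := large _ _ yD xD; rewrite cE eqxx.
  by split; apply: (@eq_dyadic_class_small D).
have [/existsP[j /andP[xj yj]]|nolarge] :=
    boolP [exists j, (D <= x j)%N && (D <= y j)%N]; last first.
  apply: (rigid_dominated rx exy) => i; apply: (small i _).2.
  by have := existsPn nolarge i; lia.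
have smallj i : i != j -> (x i <= 2 * y i)%N /\ (y i <= 2 * x i)%N.
  move=> ij; apply: small; left; rewrite ltnNge; apply/negP => xi.
  by move: ij; rewrite (rigid_large_unique rx D0 aD xi xj) eqxx.
have [xyj|xyj] := leqP (x j) (y j).
  move=> i; apply/esym; move: i; apply: (rigid_dominated ry (esym exy)) => i.
  by have [->|/smallj[]//] := eqVneq i j; lia.
apply: (rigid_dominated rx exy) => i.
by have [->|/smallj[]//] := eqVneq i j; lia.
Qed.

(** * Encoding by support and classes, and counting codes *)

Section Code.
Context {n : nat} (D : nat).
Local Notation L := (trunc_log 2 D).

Definition code_entry (x : 'I_n -> nat) (i : 'I_n) : 'I_n * 'I_L.+2 :=
  (i, Ordinal (dyadic_class_ltn D (x i))).

(** The enumerated support, padded with [None] to the length allowed by [rigid_support]; a longer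
    support would be cut off. *)
Definition code (x : 'I_n -> nat) :
    {ffun 'I_(2 * L + 4) -> option ('I_n * 'I_L.+2)} :=
  [ffun k : 'I__ =>
    nth None [seq Some (code_entry x i) | i <- enum (supp x)] k].

Lemma code_eq (x y : 'I_n -> nat) :
  (#|supp x| <= 2 * L + 4)%N -> code x = code y ->
  {in supp x, forall i,
    i \in supp y /\ dyadic_class D (x i) = dyadic_class D (y i)}.
Proof.
move=> sx /ffunP exy i ix; pose k := index i (enum (supp x)).
have kx : (k < size (enum (supp x)))%N by rewrite index_mem mem_enum.
have kN : (k < 2 * L + 4)%N by apply: leq_trans sx; rewrite cardE.
have := exy (Ordinal kN); rewrite !ffunE /= (nth_map i) //.
rewrite nth_index ?mem_enum //.
have [ky|ky] := ltnP k (size (enum (supp y))); last first.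
  by rewrite nth_default ?size_map.
rewrite (nth_map i) // => -[iE cE].
by rewrite -iE in cE; split=> //; rewrite iE -mem_enum mem_nth.
Qed.

Lemma card_code :
  #|{ffun 'I_(2 * L + 4) -> option ('I_n * 'I_L.+2)}| =
  ((n * L.+2).+1 ^ (2 * L + 4))%N.
Proof. by rewrite card_ffun card_option card_prod !card_ord. Qed.

End Code.

Lemma rigid_code_inj {n : nat} {a : 'I_n -> int} {x y : 'I_n -> nat} {D : nat} :
  rigid a x -> rigid a y -> (1 < D)%N -> (forall k, (`|a k| <= D)%N) ->
  \sum_i a i * (x i)%:Z = \sum_i a i * (y i)%:Z ->
  code D x = code D y -> x =1 y.
Proof.
move=> rx ry D1 aD exy cxy.
have cx := code_eq _ _ _ (rigid_support rx D1 aD) cxy.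
have cy := code_eq _ _ _ (rigid_support ry D1 aD) (esym cxy).
apply: (rigid_eq rx ry (ltnW D1) aD exy) => [|i /cx[]//].
by apply/setP => i; apply/idP/idP => [/cx[]|/cy[]].
Qed.

Lemma inj_finite_card {T : choiceType} {F : finType} (V : set T) (f : T -> F) :
  {in V &, injective f} -> finite_set V /\ (#|` fset_set V| <= #|F|)%N.
Proof.
move=> finj.
have [g gE] := Pinj finj.
have gV := card_image g.
have Vfin : finite_set V by rewrite -(eq_finite_set gV); exact: finite_finset.
split=> //.
have /fcard_eq <- // := gV; last exact: finite_finset.
by rewrite -(card_uniqP (fset_uniq _)) max_card.
Qed.

(** * Vertices of the integer hull are rigid *)

Section Hull.
Context {R : realType} {n : nat}.
Implicit Types (A P : set 'cV[R]_n) (v p q : 'cV[R]_n).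

Lemma sub_conv_hull A : A `<=` conv_hull A.
Proof.
move=> p Ap; exists 1%N, (fun=> 1), (fun=> p).
by split=> //; rewrite big_ord1 // scale1r.
Qed.

(** If [v] were outside [A], any combination of points of [A] giving [v] would avoid [v] itself. *)
Lemma vertex_conv_hull A v : vertices (conv_hull A) v -> A v.
Proof.
move=> [[k [w [p [w0 w1 Ap vE]]]] vNc]; apply: contrapT => NAv; apply: vNc.
exists k, w, p; split=> // i; split; first exact/sub_conv_hull/Ap.
by move=> piv; apply: NAv; rewrite -piv.
Qed.

Lemma vertex_midpoint P v p q :
  vertices P v -> P p -> P q -> p + q = v + v -> p = v.
Proof.
move=> [Pv vNc] Pp Pq pqv; apply: contrapT => pv; apply: vNc.
have qv : q <> v by move=> qv; apply: pv; move: pqv; rewrite qv => /addIr.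
exists 2%N, (fun=> 2^-1), (fun i => if i == ord0 then p else q).
split=> [i||i|]; first by rewrite invr_ge0.
- by rewrite big_ord_recl big_ord1 -div1r -splitr.
- by case: ifP.
rewrite big_ord_recl big_ord1 /= -scalerDr pqv -mulr2n.
by rewrite -[v *+ 2]scaler_nat scalerA mulVf ?scale1r // pnatr_eq0.
Qed.

Lemma knapsack_natP (a : 'cV[int]_n) (b : int) p :
  (knapsack R a b `&` int_points R n) p <->
  exists2 x : 'I_n -> nat, p = \col_i (x i)%:R &
    \sum_i a i 0 * (x i)%:Z = b.
Proof.
have dotE (x : 'I_n -> nat) :
    (map_mx intr a)^T *m (\col_i (x i)%:R : 'cV[R]_n) =
    ((\sum_i a i 0 * (x i)%:Z)%:~R)%:M.
  apply/matrixP => i j; rewrite !ord1 !mxE eqxx mulr1n rmorph_sum /=.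
  by apply: eq_bigr => k _; rewrite !mxE rmorphM /=.
split=> [[[pb p0] pint]|[x -> xb]].
  have pE : p = \col_i (Num.truncn (p i 0))%:R.
    apply/matrixP => i j; rewrite ord1 !mxE truncnK //.
    by rewrite natrEint pint p0.
  exists (fun i => Num.truncn (p i 0)) => //.
  move: pb; rewrite [p in _ *m p]pE dotE => /matrixP/(_ 0 0).
  by rewrite !mxE eqxx !mulr1n => /intr_inj.
split; [split=> [|i]|move=> i].
- by rewrite dotE xb.
- by rewrite mxE.
- by rewrite mxE intr_nat // natr_nat.
Qed.

Lemma vertex_rigid (a : 'cV[int]_n) (b : int) v :
  vertices (integer_hull R a b) v ->
  exists x : 'I_n -> nat, [/\ v = \col_i (x i)%:R,
    \sum_i a i 0 * (x i)%:Z = b & rigid (fun i => a i 0) x].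
Proof.
move=> vV; have /knapsack_natP[x vE xb] := vertex_conv_hull _ _ vV.
exists x; split=> // z az zx i.
have inhull (y : 'I_n -> int) : \sum_i a i 0 * y i = b ->
    (forall i, 0 <= y i) -> integer_hull R a b (\col_i (y i)%:~R).
  move=> yb y0; apply/sub_conv_hull/knapsack_natP.
  exists (fun i => `|y i|%N); last first.
    by rewrite -yb; apply: eq_bigr => k _; rewrite gez0_abs.
  by apply/matrixP => k l; rewrite !mxE -[in LHS](gez0_abs (y0 k)).
have /matrixP/(_ i 0) : \col_i ((x i)%:Z + z i)%:~R = v.
  apply: (vertex_midpoint _ _ _ (\col_i ((x i)%:Z - z i)%:~R) vV).
  - apply: inhull => [|k]; last by have := zx k; lia.
    by under eq_bigr do rewrite mulrDr; rewrite big_split /= az addr0.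
  - apply: inhull => [|k]; last by have := zx k; lia.
    by under eq_bigr do rewrite mulrBr; rewrite sumrB /= az subr0.
  - apply/matrixP => k l; rewrite vE !mxE -[(x k)%:R]/((x k)%:Z%:~R) -!intrD.
    by congr (_%:~R); lia.
by rewrite vE !mxE -[(x i)%:R]/((x i)%:Z%:~R) => /intr_inj; lia.
Qed.

End Hull.

(** * The bound in real logarithms *)

Lemma trunc_log_le_log2 (R : realType) (D : nat) :
  (0 < D)%N -> (trunc_log 2 D)%:R <= log2 D%:R :> R.
Proof.
move=> D0; rewrite /log2 ler_pdivlMr ?ln_gt0 ?ltr1n // mulr_natl -lnXn //.
by rewrite -natrX ler_ln ?posrE ?ltr0n ?ler_nat ?expn_gt0 ?trunc_logP.
Qed.

Lemma log2_ge1 (R : realType) (D : nat) : (1 < D)%N -> 1 <= log2 D%:R :> R.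
Proof.
move=> D1; apply: le_trans (trunc_log_le_log2 R D _); last by lia.
by rewrite ler1n trunc_log_gt0.
Qed.

(** With [B >= 2], the base is at most [3 * B + 1 <= 4 * B <= B ^+ 3], and the exponent is at most
    [6 * l]; hence [18 = 3 * 6]. *)
Lemma card_bound_le_powR (R : realType) (n D : nat) :
  (1 < n)%N -> (1 < D)%N ->
  (((n * (trunc_log 2 D).+2).+1 ^ (2 * trunc_log 2 D + 4))%N)%:R <=
  (n%:R * log2 D%:R) `^ (18 * log2 D%:R) :> R.
Proof.
move=> n1 D1; set L := trunc_log 2 D; set l : R := log2 D%:R.
have Ll : L%:R <= l by apply: trunc_log_le_log2; lia.
have l1 : 1 <= l by exact: log2_ge1.
have n2 : 2 <= n%:R :> R by rewrite ler_nat.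
set B := n%:R * l.
have B2 : 2 <= B by rewrite /B; nra.
have base : (n * L.+2).+1%:R <= B ^+ 3.
  apply: (@le_trans _ _ (4 * B)); last by rewrite !exprS expr0; nra.
  by rewrite -natr1 natrM -addn2 natrD /B; nra.
rewrite natrX; apply: (@le_trans _ _ ((B ^+ 3) ^+ (2 * L + 4))).
  by rewrite lerXn2r ?nnegrE ?exprn_ge0 //; lra.
rewrite -exprM -powR_mulrn; last by lra.
by apply: ler_powR; [lra | rewrite natrM natrD natrM; lra].
Qed.

(* mx_norm is the max-norm of the entries. When it is 1 the bound would read
   0 `^ 0, which fails already for a = (1, 1), b = 1; hence 2 <= mx_norm a. *)
Theorem theorem9 (R : realType) :
  exists C : R, forall (n : nat) (a : 'cV[int]_n) (b : int),
    a != 0 -> 2 <= mx_norm a ->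
    let Delta : R := (mx_norm a)%:~R in
    let V := vertices (integer_hull R a b) in
    finite_set V /\
    (#|` fset_set V|)%:R <= (n%:R * log2 Delta) `^ (C * log2 Delta).
Proof.
exists 18 => n a b a0 a2 Delta V.
pose D := `|mx_norm a|%N.
have DE : mx_norm a = D%:Z by rewrite /D; lia.
have D1 : (1 < D)%N by lia.
have DeltaE : Delta = D%:R by rewrite /Delta DE.
have aD i : (`|a i 0%R| <= D)%N.
  suff : `|a i 0| <= mx_norm a by lia.
  by rewrite mx_normrE; apply/bigmax_geP; right; exists (i, 0).
pose x (v : 'cV[R]_n) i := Num.truncn (v i 0).
have xV v : V v -> [/\ v = \col_i (x v i)%:R,
    \sum_i a i 0 * (x v i)%:Z = b & rigid (fun i => a i 0) (x v)].
  move=> /vertex_rigid[y [vE yb ry]].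
  have -> : x v = y by apply/funext => i; rewrite /x vE mxE natrK.
  by [].
have xinj u v : V u -> V v -> x u =1 x v -> u = v.
  move=> /xV[uE _ _] /xV[vE _ _] uv; rewrite uE vE.
  by apply/matrixP => i j; rewrite !mxE uv.
rewrite DeltaE; have [n1|n1] := ltnP 1 n.
  have cinj : {in V &, injective (fun v => code D (x v))}.
    move=> u v; rewrite !inE => Vu Vv cuv; apply: xinj => //.
    have [_ ub ru] := xV _ Vu; have [_ vb rv] := xV _ Vv.
    by apply: (rigid_code_inj ru rv D1 aD _ cuv); rewrite ub vb.
  have [Vfin Vcard] := inj_finite_card _ _ cinj; split=> //.
  apply: le_trans (card_bound_le_powR R _ _ n1 D1).
  by rewrite ler_nat -card_code.
(* For [n = 1] and [Delta < 4] the base may be below 2, so the bound needs that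
   there is at most one vertex. *)
have n_gt0 : (0 < n)%N.
  by rewrite lt0n; apply: contraNneq a0 => n0; subst n; rewrite flatmx0.
have nE : n = 1%N by lia.
have uinj : {in V &, injective (fun=> tt)}.
  move=> u v; rewrite !inE => Vu Vv _; apply: xinj => //.
  have [_ ub ru] := xV _ Vu; have [_ vb rv] := xV _ Vv.
  pose i := Ordinal n_gt0.
  have iP k : k = i by apply: val_inj => /=; have := ltn_ord k; lia.
  (* With a single coordinate any two vectors are comparable, and the larger one dominates the
     smaller. *)
  have [uv|vu] := leqP (x u i) (x v i).
    move=> k; apply/esym; move: k; apply: rigid_dominated rv _ _ => [|k].
      by rewrite ub vb.
    by rewrite (iP k); lia.
  apply: rigid_dominated ru _ _ => [|k]; first by rewrite ub vb.
  by rewrite (iP k); lia.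
have [Vfin] := inj_finite_card _ _ uinj; rewrite card_unit => Vcard.
split=> //; have l1 := log2_ge1 R _ D1; rewrite [n%:R](_ : _ = 1) ?nE // mul1r.
apply: (@le_trans _ _ 1); first by rewrite lern1.
apply: (le_trans l1); apply: le1r_powR => //; lra.
Qed.
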